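(* Let $G$ be a hyperbolic group, let $n \in \mathbb{N}$, $n\ge 1$, and let $A_1, \dots, A_n \subset G$ be quasiconvex subsets. Then the product set $A_1A_2\cdots A_n = \{a_1a_2\cdots a_n \mid a_i \in A_i,\ i=1,\dots,n\} \subset G$ is also quasiconvex.
   Context: Let $G$ be a hyperbolic group with a finite symmetrized generating set $\mathcal{A}$ (i.e. $a\in\mathcal A$ implies $a^{-1}\in\mathcal A$) and let $\Gamma(G,\mathcal{A})$ be its Cayley graph with the usual metric. A subset $Q \subseteq G$ is $\varepsilon$-quasiconvex ($\varepsilon\ge 0$) if every geodesic in $\Gamma(G,\mathcal{A})$ connecting two elements of $Q$ lies in the closed $\varepsilon$-neighborhood of $Q$ in $\Gamma(G,\mathcal{A})$; $Q$ is quasiconvex if it is $\varepsilon$-quasiconvex for some $\varepsilon$. In a hyperbolic group this does not depend on the choice of the finite generating set. *)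

(* Defs.v *)
(* MathComp / MathComp-Analysis.  Groups are arbitrary (possibly infinite)
   [groupType]s; subsets are classical sets. *)
From mathcomp Require Import all_boot all_order all_algebra.
From mathcomp Require Import all_classical all_reals.
From mathcomp Require Import ereal.

Set Implicit Arguments.
Unset Strict Implicit.
Unset Printing Implicit Defensive.

Import Order.TTheory GRing.Theory Num.Theory.
Local Open Scope classical_set_scope.
Local Open Scope ring_scope.

Section GeodesicSpace.
Context {R : realType} {T : Type}.
(* A metric space is given by its carrier [X], as a subset of an ambient type,
   and its distance function [d]. *)
Variables (X : set T) (d : T -> T -> R).

(* [s] is the image of an isometric embedding of [0, l] into [X] that starts
   at [x] and ends at [y]. *)
Definition geodesic_segment (x y : T) (s : set T) : Prop :=
  exists c : R -> T, exists l : R,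
    [/\ 0 <= l, c 0 = x, c l = y,
        (forall t : R, t \in `[0, l] -> X (c t)) &
        (forall t u : R, t \in `[0, l] -> u \in `[0, l] ->
           d (c t) (c u) = `|t - u|)]
    /\ s = c @` [set` `[0, l]].

(* The infimum is taken in [\bar R], so that no point is at finite distance
   from the empty set. *)
Definition closed_nbhd (e : R) (Q : set T) : set T :=
  [set x | X x /\ (ereal_inf [set (d x q)%:E | q in Q] <= e%:E)%E].

(* Rips condition: every side of a geodesic triangle lies in the closed
   [delta]-neighborhood of the union of the other two (one inclusion is
   enough, as [x], [y], [z] can be rotated). *)
Definition slim_triangles (delta : R) : Prop :=
  forall (x y z : T) (sxy syz szx : set T),
    geodesic_segment x y sxy ->
    geodesic_segment y z syz ->
    geodesic_segment z x szx ->
    sxy `<=` closed_nbhd delta (syz `|` szx).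

Definition hyperbolic_space : Prop :=
  exists2 delta : R, 0 <= delta & slim_triangles delta.

End GeodesicSpace.

Section CayleyGraph.
Variables (R : realType) (G : groupType).
Implicit Types (S Q : set G) (g x y : G).

(* Since [S] is closed under inversion, the words in [S] are exactly the words
   in [S] and its inverses. *)
Definition finite_symmetrized_generating_set S : Prop :=
  [/\ finite_set S,
      (forall a, S a -> S (a^-1)%g) &
      (forall g, exists2 w : seq G,
         [set` w] `<=` S & (\prod_(a <- w) a)%g = g)].

Definition word_length S g : R :=
  inf [set (size w)%:R | w in
         [set w : seq G | [set` w] `<=` S /\ (\prod_(a <- w) a)%g = g]].

Definition word_dist S x y : R := word_length S (x^-1 * y)%g.

(* No loop is created if [S] contains [1]. *)
Definition adjacent S x y : Prop := x <> y /\ S (x^-1 * y)%g.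

(* Points of the geometric realization of the Cayley graph are represented by
   their barycentric coordinates, i.e. by functions [G -> R]: a point of an
   edge {x, y} is a convex combination of its ends, so an edge and its inverse
   have the same points and equality of points is Leibniz equality. *)
Definition vertex x : G -> R := fun z => (z == x)%:R.

Definition cayley_graph S : set (G -> R) :=
  range vertex `|`
  [set p | exists x y, exists t : R,
     [/\ adjacent S x y, 0 <= t <= 1 &
         p = fun z => (1 - t) * vertex x z + t * vertex y z]].

(* Path metric, with edges of length 1.  A vertex [u] in the support of a point
   [p] is joined to [p] by a part of an edge, of length [1 - p u].  A shortest
   path from [p] to [q] either passes through vertices [u] and [v] of the
   supports of [p] and [q], or stays inside an edge {u, v} containing both. *)
Definition cayley_dist S (p q : G -> R) : R :=
  inf ([set r | exists u v, [/\ 0 < p u, 0 < q v &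
                   r = (1 - p u) + word_dist S u v + (1 - q v)]]
       `|`
       [set r | exists u v, [/\ adjacent S u v, p u + p v = 1, q u + q v = 1 &
                   r = `|p u - q u|]]).

Definition hyperbolic_group S : Prop :=
  hyperbolic_space (cayley_graph S) (cayley_dist S).

Definition eps_quasiconvex S (e : R) Q : Prop :=
  forall x y (s : set (G -> R)), Q x -> Q y ->
    geodesic_segment (cayley_graph S) (cayley_dist S) (vertex x) (vertex y) s ->
    s `<=` closed_nbhd (cayley_graph S) (cayley_dist S) e (vertex @` Q).

Definition quasiconvex S Q : Prop :=
  exists2 e : R, 0 <= e & eps_quasiconvex S e Q.

Definition product_set (n : nat) (A : 'I_n -> set G) : set G :=
  [set g | exists2 a : 'I_n -> G,
     (forall i, A i (a i)) & g = (\prod_(i < n) a i)%g].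

End CayleyGraph.

(* Main.v *)
Require Import Defs.
From mathcomp Require Import all_boot all_order all_algebra.
From mathcomp Require Import all_classical all_reals.
From mathcomp Require Import ereal archimedean lra zify.

(** By induction on the number of factors, it is enough to show that [A B] is
    quasiconvex when [A] and [B] are.  Fix [b0] in [B].  A geodesic from
    [a1 b1] to [a2 b2] is one side of a geodesic quadrilateral whose other
    vertices are [a1] and [a2]; two slim triangles show that it stays close to
    the three other sides ([quasiconvex_mul]).
    - The side from [a1] to [a2] is close to [A], as [A] is quasiconvex, hence
      to [A b0], as right multiplication by [b0] moves elements of the group by
      the constant distance [|b0|].
    - The sides from [ai] to [ai bi] are close to [ai B]
      ([coset_segment_near]): in a triangle with third vertex [ai b0], one of
      the other sides joins two elements of [ai B] and is a translate of a
      geodesic between elements of [B], and the other one has length [|b0|].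

    Only the existence of the bounds matters, so additive errors are harmless.
    A point of the Cayley graph is replaced with any vertex of its support
    ([quasiconvex_vertices] and [slim_vertices]), which changes distances by at
    most 2 ([cayley_dist_le] and [word_dist_le]).  All estimates are then
    triangle inequalities for the word metric.

    The auxiliary sides of the triangles must exist as geodesic segments
    of the geometric realization: [geodesic_exists] builds them from shortest
    words, whose prefixes are the vertices of an isometrically embedded path. *)

Section HyperbolicGroup.
Set Implicit Arguments.
Unset Strict Implicit.
Unset Printing Implicit Defensive.
Local Open Scope classical_set_scope.
Local Open Scope ring_scope.
Import Order.TTheory GRing.Theory Num.Theory.

Variables (R : realType) (G : groupType) (S : set G).
Hypothesis HS : finite_symmetrized_generating_set S.

Local Notation wd := (word_dist R S).

(** * The word metric *)

Definition represents (w : seq G) (g : G) : Prop :=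
  [set` w] `<=` S /\ (\prod_(a <- w) a)%g = g.

Lemma represents_cat w1 w2 g1 g2 :
  represents w1 g1 -> represents w2 g2 -> represents (w1 ++ w2) (g1 * g2)%g.
Proof.
move=> [S1 p1] [S2 p2]; split; last by rewrite big_cat /= p1 p2.
by move=> a /=; rewrite mem_cat => /orP[/S1|/S2].
Qed.

Lemma representsV w g : represents w g ->
  exists2 w', size w' = size w & represents w' (g^-1)%g.
Proof.
have [_ SV _] := HS.
move=> [Sw <-]; exists (rev (map (fun a => a^-1)%g w)).
  by rewrite size_rev size_map.
split.
  by move=> a /=; rewrite mem_rev => /mapP[b /Sw Sb ->]; exact: SV.
elim: w {Sw} => [|a w IH]; first by rewrite !big_nil invg1.
by rewrite /= rev_cons -cats1 big_cat big_seq1 big_cons invgM /= IH.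
Qed.

Lemma word_length_le w g : represents w g -> word_length R S g <= (size w)%:R.
Proof.
move=> wg; apply: ge_inf; last by exists w.
by exists 0 => _ [w' _ <-]; rewrite ler0n.
Qed.

(** The infimum that defines the word length ranges over natural numbers, so
    it is a minimum. *)
Lemma word_length_attained g :
  exists2 w, represents w g & word_length R S g = (size w)%:R.
Proof.
have [_ _ gen] := HS.
have ex : exists n, `[< exists2 w, represents w g & size w = n >].
  by have [w Sw wg] := gen g; exists (size w); apply/asboolP; exists w.
case: (ex_minnP ex) => n /asboolP[w wg sw] nmin.
exists w => //; apply/eqP; rewrite eq_le word_length_le //=.
apply: lb_le_inf; first by exists (size w)%:R, w.
move=> _ [w' w'g <-]; rewrite ler_nat sw.
by apply: nmin; apply/asboolP; exists w'.
Qed.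

Lemma word_dist_ge0 x y : 0 <= wd x y.
Proof. by have [w _ ew] := word_length_attained (x^-1 * y)%g; rewrite /word_dist ew. Qed.

Lemma word_dist_refl x : wd x x = 0.
Proof.
apply/eqP; rewrite eq_le word_dist_ge0 andbT /word_dist mulVg.
by apply: (@word_length_le [::]); split; rewrite ?big_nil.
Qed.

Lemma word_dist_sym_le x y : wd x y <= wd y x.
Proof.
have [w wg ew] := word_length_attained (y^-1 * x)%g.
have [w' sw' w'g] := representsV wg.
rewrite {2}/word_dist ew -sw'; apply: word_length_le.
by rewrite invgM invgK in w'g.
Qed.

Lemma word_dist_sym x y : wd x y = wd y x.
Proof. by apply/eqP; rewrite eq_le !word_dist_sym_le. Qed.

Lemma word_dist_triangle y x z : wd x z <= wd x y + wd y z.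
Proof.
have [w wg ew] := word_length_attained (x^-1 * y)%g.
have [w' wg' ew'] := word_length_attained (y^-1 * z)%g.
rewrite /word_dist ew ew' -natrD -size_cat; apply: word_length_le.
have := represents_cat wg wg'.
by rewrite mulgA -(mulgA _ y) mulgV mulg1.
Qed.

Lemma word_dist_mul g x y : wd (g * x)%g (g * y)%g = wd x y.
Proof. by rewrite /word_dist invgM !mulgA -(mulgA _ _ g) mulVg mulg1. Qed.

Lemma word_dist_adjacent x y : adjacent S x y -> wd x y <= 1.
Proof.
move=> [_ Sxy]; apply: (@word_length_le [:: (x^-1 * y)%g]).
by split; rewrite ?big_seq1 // => a /=; rewrite inE => /eqP ->.
Qed.

Lemma adjacent_of_word_dist x y : wd x y = 1 -> adjacent S x y.
Proof.
move=> xy1; split.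
  by move=> exy; move: xy1; rewrite exy word_dist_refl => /esym/eqP; rewrite oner_eq0.
have [w [Sw pw] ew] := word_length_attained (x^-1 * y)%g.
move: xy1; rewrite /word_dist ew => /eqP; rewrite pnatr_eq1.
case: w Sw pw {ew} => [//|a [|//]] Sw; rewrite big_seq1 => <- _.
by apply: Sw; rewrite /= inE.
Qed.

(** The prefixes of a shortest word trace a discrete geodesic. *)
Lemma discrete_geodesic x y : exists (n : nat) (v : nat -> G),
  [/\ v 0%N = x, v n = y, wd x y = n%:R &
   forall i j, (i <= j <= n)%N -> wd (v i) (v j) = (j - i)%:R].
Proof.
have [w [Sw pw] ew] := word_length_attained (x^-1 * y)%g.
pose v i := (x * \prod_(a <- take i w) a)%g.
have vn : v (size w) = y by rewrite /v take_size pw mulgA mulgV mul1g.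
have v0 : v 0%N = x by rewrite /v take0 big_nil mulg1.
have le i j : (i <= j <= size w)%N -> wd (v i) (v j) <= (j - i)%:R.
  move=> /andP[ij jw].
  have -> : (j - i)%N = size (drop i (take j w)).
    by rewrite size_drop size_takel.
  apply: word_length_le; split.
    by move=> a /= /mem_drop/mem_take/Sw.
  rewrite /v -{2}(cat_take_drop i (take j w)) take_takel // big_cat /=.
  by rewrite invgM !mulgA -(mulgA _ _ x) mulVg mulg1 mulVg mul1g.
exists (size w), v; split => // i j ijn.
apply/eqP; rewrite eq_le le //=.
(* Otherwise the walk from [x] to [y] through [v i] and [v j] would be too short. *)
have wxy : wd x y = (size w)%:R by rewrite /word_dist ew.
have t1 := word_dist_triangle (v i) x y.
have t2 := word_dist_triangle (v j) (v i) y.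
have := le 0%N i; have := le j (size w); rewrite v0 vn => h1 h2.
have {}h1 : wd (v j) y <= (size w - j)%:R by apply: h1; lia.
have {}h2 : wd x (v i) <= (i - 0)%:R by apply: h2; lia.
have : ((j - i) + (size w - j) + (i - 0))%N = size w by lia.
move/(congr1 (fun n => n%:R : R)); rewrite !natrD; lra.
Qed.

Local Notation graph := (@cayley_graph R G S).
Local Notation dist := (@cayley_dist R G S).
Local Notation segment := (geodesic_segment graph dist).
Local Notation nbhd := (closed_nbhd graph dist).
Local Notation vertex := (@vertex R G).

(** * Points and distances of the Cayley graph *)

(** A uniform representation of the points: a vertex is a degenerate edge. *)
Lemma cayley_graphP (p : G -> R) : graph p ->
  exists x y t, [/\ wd x y <= 1, 0 <= t <= 1 &
    p = fun z => (1 - t) * vertex x z + t * vertex y z].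
Proof.
case=> [[x _ <-]|[x [y [t [adj t01 ->]]]]].
  exists x, x, 0; split; rewrite ?word_dist_refl ?lexx ?ler01 //.
  by apply/funext => z; rewrite subr0 mul1r mul0r addr0.
by exists x, y, t; split=> //; exact: word_dist_adjacent.
Qed.

Lemma vertex_graph x : graph (vertex x).
Proof. by left; exists x. Qed.

Lemma vertex_id x : vertex x x = 1.
Proof. by rewrite /Defs.vertex eqxx. Qed.

Lemma vertex_gt0 x : 0 < vertex x x.
Proof. by rewrite vertex_id ltr01. Qed.

Lemma graph_le1 {p} u : graph p -> p u <= 1.
Proof.
move=> /cayley_graphP[x [y [t [_ t01 ->]]]]; rewrite /Defs.vertex.
by case: (u == x); case: (u == y) => /=; lra.
Qed.

Lemma graph_support p : graph p -> exists u, 0 < p u.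
Proof.
move=> /cayley_graphP[x [y [t [_ t01 ->]]]]; rewrite /Defs.vertex.
have [t1|t1] := ltP t 1.
  by exists x; rewrite eqxx; case: (x == y) => /=; lra.
by exists y; rewrite eqxx; case: (y == x) => /=; lra.
Qed.

Lemma support_dist {p u v} : graph p -> 0 < p u -> 0 < p v -> wd u v <= 1.
Proof.
move=> /cayley_graphP[x [y [t [xy t01 ->]]]].
have supp z : 0 < (1 - t) * vertex x z + t * vertex y z -> z = x \/ z = y.
  rewrite /Defs.vertex; have [->|_] := eqVneq z x; first by left.
  by have [->|_] := eqVneq z y; [right|rewrite !mulr0 addr0 ltxx].
by move=> /supp[->|->] /supp[->|->]; rewrite ?word_dist_refl ?ler01 // word_dist_sym.
Qed.

(** The coordinates of a point have sum 1, so nothing is left for a third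
    vertex. *)
Lemma support_edge {p a b u} : graph p -> a <> b -> p a + p b = 1 ->
  0 < p u -> u = a \/ u = b.
Proof.
move=> /cayley_graphP[x [y [t [_ t01 ->]]]] ab; rewrite /Defs.vertex => pab pu.
have [->|ua] := eqVneq u a; first by left.
have [->|ub] := eqVneq u b; first by right.
(* [a], [b] and [u] are distinct, so the end [z] of the edge of [p] contributes
   to at most one of the three coordinates. *)
have le1 z : (z == a)%:R + (z == b)%:R + (z == u)%:R <= 1 :> R.
  have [->|_] := eqVneq z a; last first.
    have [->|_] := eqVneq z b; last by case: (z == u) => /=; lra.
    by rewrite eq_sym (negbTE ub) /=; lra.
  by rewrite (introF eqP ab) eq_sym (negbTE ua) /=; lra.
exfalso; move: pab pu (le1 x) (le1 y); rewrite !(eq_sym x) !(eq_sym y); nra.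
Qed.

Lemma cayley_dist_has_lbound p q : graph p -> graph q ->
  has_lbound ([set r | exists u v, [/\ 0 < p u, 0 < q v &
                   r = (1 - p u) + wd u v + (1 - q v)]]
       `|`
       [set r | exists u v, [/\ adjacent S u v, p u + p v = 1, q u + q v = 1 &
                   r = `|p u - q u|]]).
Proof.
move=> gp gq; exists 0 => r [[u [v [_ _ ->]]]|[u [v [_ _ _ ->]]]]; last exact: normr_ge0.
have := graph_le1 u gp; have := graph_le1 v gq; have := word_dist_ge0 u v; lra.
Qed.

Lemma cayley_dist_le_via {p q u v} : graph p -> graph q -> 0 < p u -> 0 < q v ->
  dist p q <= (1 - p u) + wd u v + (1 - q v).
Proof.
move=> gp gq pu qv; apply: ge_inf; first exact: cayley_dist_has_lbound.
by left; exists u, v.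
Qed.

Lemma cayley_dist_le_edge {p q u v} : graph p -> graph q ->
  adjacent S u v -> p u + p v = 1 -> q u + q v = 1 ->
  dist p q <= `|p u - q u|.
Proof.
move=> gp gq a pu qv; apply: ge_inf; first exact: cayley_dist_has_lbound.
by right; exists u, v.
Qed.

Lemma cayley_dist_ge r p q : graph p -> graph q ->
  (forall u v, 0 < p u -> 0 < q v -> r <= (1 - p u) + wd u v + (1 - q v)) ->
  (forall u v, adjacent S u v -> p u + p v = 1 -> q u + q v = 1 ->
     r <= `|p u - q u|) ->
  r <= dist p q.
Proof.
move=> gp gq h1 h2; apply: lb_le_inf.
  have [u pu] := graph_support gp; have [v qv] := graph_support gq.
  by eexists; left; exists u, v.
by move=> s [[u [v [pu qv ->]]]|[u [v [a pu qv ->]]]]; [exact: h1|exact: (h2 u v)].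
Qed.

(** With the next lemma, this reduces coarse estimates in the Cayley graph to
    estimates of the word metric; in particular, it makes up for the triangle
    inequality of [dist]. *)
Lemma cayley_dist_le p q u v : graph p -> graph q -> 0 < p u -> 0 < q v ->
  dist p q <= wd u v + 2.
Proof. by move=> gp gq pu qv; have := cayley_dist_le_via gp gq pu qv; lra. Qed.

Lemma word_dist_le p q u v : graph p -> graph q -> 0 < p u -> 0 < q v ->
  wd u v <= dist p q + 2.
Proof.
move=> gp gq pu qv; rewrite -lerBlDr; apply: cayley_dist_ge => // u' v'.
  move=> pu' qv'.
  have := support_dist gp pu pu'; have := support_dist gq qv' qv.
  have := word_dist_triangle u' u v; have := word_dist_triangle v' u' v.
  have := graph_le1 u' gp; have := graph_le1 v' gq; lra.
move=> adj pe qe; have [ab _] := adj.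
have uv1 : wd u v <= 1.
  have w1 := word_dist_adjacent adj.
  have [->|->] := support_edge gp ab pe pu; have [->|->] := support_edge gq ab qe qv;
    by rewrite ?word_dist_refl ?ler01 // word_dist_sym.
have := normr_ge0 (p u' - q u'); lra.
Qed.

(** The infimum in the definition of the neighborhood is attained up to an
    additive error; 1 is an arbitrary choice. *)
Lemma closed_nbhd_near e Q p : nbhd e Q p -> exists2 q, Q q & dist p q < e + 1.
Proof.
move=> [_ h]; have /ereal_inf_lt[_ [q Qq <-]] : 
  (ereal_inf [set (dist p q)%:E | q in Q] < (e + 1)%:E)%E.
  by apply: (le_lt_trans h); rewrite lte_fin ltrDl ltr01.
by rewrite lte_fin; exists q.
Qed.

Lemma near_closed_nbhd e Q p q : graph p -> Q q -> dist p q <= e -> nbhd e Q p.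
Proof.
move=> gp Qq pq; split=> //; apply: ge_ereal_inf.
by exists (dist p q)%:E; [exists q|rewrite lee_fin].
Qed.

Lemma segment_graph {p q s r} : segment p q s -> s r -> graph r.
Proof.
by move=> [c [l [[l0 c0 cl gc dc] ->]]] [t /= tl <-]; exact: gc.
Qed.

Lemma segment_dist_end x y s r u : segment (vertex x) (vertex y) s -> s r ->
  0 < r u -> wd u y <= wd x y + 2.
Proof.
move=> sg sr ru; have gr := segment_graph sg sr.
have xy := cayley_dist_le_via (vertex_graph x) (vertex_graph y) (vertex_gt0 x) (vertex_gt0 y).
have uy := word_dist_le gr (vertex_graph y) ru (vertex_gt0 y).
have ry : dist r (vertex y) <= dist (vertex x) (vertex y).
  case: sg sr => c [l [[l0 c0 cl gc dc] ->]] [t /= + <-].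
  rewrite in_itv /= => /andP[t0 tl].
  rewrite -c0 -cl !dc ?in_itv /= ?t0 ?tl ?lexx ?l0 //.
  by rewrite !ler0_norm ?subr_le0 ?lerD2r ?lerN2 //; lra.
by move: xy; rewrite !vertex_id; lra.
Qed.

(** * Translations *)

Definition translate (g : G) (p : G -> R) : G -> R := fun z => p (g^-1 * z)%g.

Lemma translate_vertex g x : translate g (vertex x) = vertex (g * x)%g.
Proof.
apply/funext => z; rewrite /translate /Defs.vertex; congr (_%:R).
by rewrite -(inj_eq (mulgI g)) mulgA mulgV mul1g.
Qed.

Lemma adjacent_mul g x y : adjacent S x y -> adjacent S (g * x)%g (g * y)%g.
Proof.
move=> [xy Sxy]; split; first by move/mulgI.
by rewrite invgM !mulgA -(mulgA _ _ g) mulVg mulg1.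
Qed.

Lemma translate_graph g p : graph p -> graph (translate g p).
Proof.
case=> [[x _ <-]|[x [y [t [adj t01 ->]]]]].
  by rewrite translate_vertex; exact: vertex_graph.
right; exists (g * x)%g, (g * y)%g, t; split=> //; first exact: adjacent_mul.
by rewrite -!translate_vertex.
Qed.

Lemma translate_dist g p q : dist (translate g p) (translate g q) = dist p q.
Proof.
rewrite /cayley_dist; congr inf.
have tg h p' x : translate h p' (h * x)%g = p' x by rewrite /translate mulgA mulVg mul1g.
apply/seteqP; split=> r [] [u [v]].
- move=> [pu qv ->]; left; exists (g^-1 * u)%g, (g^-1 * v)%g.
  by rewrite word_dist_mul.
- move=> [a pu qv ->]; right; exists (g^-1 * u)%g, (g^-1 * v)%g; split=> //.
  exact: adjacent_mul.
- move=> [pu qv ->]; left; exists (g * u)%g, (g * v)%g.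
  by rewrite !tg word_dist_mul.
- move=> [a pu qv ->]; right; exists (g * u)%g, (g * v)%g.
  by rewrite !tg; split=> //; exact: adjacent_mul.
Qed.

Lemma translate_segment g p q s : segment p q s ->
  segment (translate g p) (translate g q) (translate g @` s).
Proof.
move=> [c [l [[l0 c0 cl gc dc] ->]]]; exists (translate g \o c), l; split.
  split=> //=; rewrite ?c0 ?cl //; first by move=> t /gc; exact: translate_graph.
  by move=> t u tl ul; rewrite translate_dist dc.
by rewrite image_comp.
Qed.

(** * Existence of geodesics *)

(** The barycentric coordinate, at a vertex of a path, of the point of the path
    at signed distance [t] from this vertex. *)
Definition hat (t : R) : R := Num.max 0 (1 - `|t|).

Lemma hat_gt0 t : 0 < hat t -> hat t = 1 - `|t|.
Proof. by rewrite /hat lt_max ltxx /= => /ltW/max_idPr. Qed.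

Lemma hat_in t : `|t| <= 1 -> hat t = 1 - `|t|.
Proof. by rewrite /hat => t1; apply/max_idPr; rewrite subr_ge0. Qed.

Lemma hat_out t : 1 <= `|t| -> hat t = 0.
Proof. by rewrite /hat => t1; apply/max_idPl; rewrite subr_le0. Qed.

Lemma hat_right t : 0 <= t <= 1 -> hat t = 1 - t.
Proof. by move=> /andP[t0 t1]; rewrite hat_in ger0_norm. Qed.

Lemma hat_left t : -1 <= t <= 0 -> hat t = 1 + t.
Proof. by move=> ?; rewrite hat_in ler0_norm ?opprK; lra. Qed.

Lemma hat_lt1 t : t != 0 -> hat t < 1.
Proof. by move=> t0; rewrite /hat gt_max ltr01 ltrBlDr ltrDl normr_gt0. Qed.

Lemma hat_eq1 t : hat t = 1 -> t = 0.
Proof. by have [//|/hat_lt1 + e] := eqVneq t 0; rewrite e ltxx. Qed.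

(** If a point of the path lies on the edge between two consecutive vertices, as
    seen from its coordinates, then its parameter lies between theirs. *)
Lemma hat_sum_eq1 t : hat t + hat (t - 1) = 1 -> 0 <= t <= 1.
Proof.
move=> h; apply/andP; split; rewrite leNgt; apply/negP => t0.
  have : hat t < 1 by apply: hat_lt1; rewrite lt_eqF.
  by move: h; rewrite (@hat_out (t - 1)) ?ler0_norm; lra.
have : hat (t - 1) < 1 by apply: hat_lt1; rewrite subr_eq0 gt_eqF.
by move: h; rewrite (@hat_out t) ?ger0_norm; lra.
Qed.

Section DiscreteGeodesic.
Variables (n : nat) (v : nat -> G).
Hypothesis hv : forall i j, (i <= j <= n)%N -> wd (v i) (v j) = (j - i)%:R.

(** The parametrization by arc length: since [hat] vanishes off [-1, 1], the sum
    has at most two nonzero terms.  A single formula on all edges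
    avoids gluing them. *)
Definition path_point (t : R) : G -> R :=
  fun z => \sum_(i < n.+1) hat (t - i%:R) * vertex (v i) z.

Lemma path_dist i j : (i <= n)%N -> (j <= n)%N ->
  wd (v i) (v j) = `|i%:R - j%:R|.
Proof.
move=> iN jN; have [ij|/ltnW ji] := leqP i j.
  by rewrite hv ?ij // distrC -natrB // normr_nat.
by rewrite word_dist_sym hv ?ji // -natrB // normr_nat.
Qed.

Lemma path_inj i j : (i <= n)%N -> (j <= n)%N -> v i = v j -> i = j.
Proof.
move=> iN jN vij; have := path_dist iN jN; rewrite vij word_dist_refl.
by move/esym/eqP; rewrite normr_eq0 subr_eq0 eqr_nat => /eqP.
Qed.

(** The vertices [v i] are distinct, so only one term of the sum is nonzero. *)
Lemma path_point_at t i : (i <= n)%N -> path_point t (v i) = hat (t - i%:R).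
Proof.
rewrite -ltnS => iN; rewrite /path_point (bigD1 (Ordinal iN)) //= vertex_id mulr1.
rewrite big1 ?addr0 // => j ji; rewrite /Defs.vertex.
case: eqP => [e|_]; last by rewrite mulr0.
case/eqP: ji; apply/val_inj/esym => /=.
by apply: path_inj e => //; rewrite -ltnS.
Qed.

Lemma path_point_off t z : (forall i, (i <= n)%N -> z <> v i) -> path_point t z = 0.
Proof.
move=> zv; rewrite /path_point big1 // => i _; rewrite /Defs.vertex.
by case: eqP => [/zv|]; rewrite ?mulr0 // -ltnS ltn_ord => /(_ isT).
Qed.

Lemma on_pathP z : (exists2 i, (i <= n)%N & z = v i) \/ (forall i, (i <= n)%N -> z <> v i).
Proof.
have [|h] := pselect (exists2 i, (i <= n)%N & z = v i); first by left.
by right => i iN zi; apply: h; exists i.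
Qed.

Lemma path_point_edge t k : (k < n)%N -> k%:R <= t <= k.+1%:R ->
  path_point t = fun z => (1 - (t - k%:R)) * vertex (v k) z + (t - k%:R) * vertex (v k.+1) z.
Proof.
move=> kn; rewrite -natr1 => tk; apply/funext => z.
have kn' := ltnW kn.
have [[i iN ->]|zv] := on_pathP z; last first.
  rewrite path_point_off // /Defs.vertex.
  by do 2 rewrite (introF eqP (zv _ _)) //; rewrite !mulr0 addr0.
have vE j : (j <= n)%N -> vertex (v j) (v i) = (i == j)%:R.
  move=> jN; rewrite /Defs.vertex; congr ((nat_of_bool _)%:R).
  by apply/eqP/eqP => [/path_inj->|->].
rewrite path_point_at // !vE //.
have [->|ik] := eqVneq i k.
  by rewrite ltn_eqF // hat_right /=; lra.
have [->|ik'] := eqVneq i k.+1.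
  by rewrite -natr1 hat_left /=; lra.
rewrite !mulr0 addr0 hat_out //.
have : (i.+1 <= k)%N \/ (k.+2 <= i)%N by lia.
move=> []; rewrite -(ler_nat R).
  by rewrite -natr1 => ?; rewrite ger0_norm; lra.
by rewrite -!natr1 => ?; rewrite ler0_norm; lra.
Qed.

Lemma path_point_vertex k : (k <= n)%N -> path_point k%:R = vertex (v k).
Proof.
move=> kn; apply/funext => z.
have [[i iN ->]|zv] := on_pathP z; last first.
  by rewrite path_point_off // /Defs.vertex (introF eqP (zv _ _)).
rewrite path_point_at // /Defs.vertex; have [->|ik] := eqVneq i k.
  by rewrite eqxx subrr hat_in normr0 ?subr0 ?ler01.
rewrite hat_out; first by case: eqP => // /path_inj e; rewrite e ?eqxx in ik.
rewrite distrC -path_dist // ; have [ik'|ik'] := leqP i k.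
  rewrite hv ?ik' // ler1n; lia.
by rewrite word_dist_sym hv ?(ltnW ik') // ler1n; lia.
Qed.

Lemma path_edge_adjacent k : (k < n)%N -> adjacent S (v k) (v k.+1).
Proof. by move=> kn; apply: adjacent_of_word_dist; rewrite hv ?leqnSn // subSnn. Qed.

Lemma path_cases (t : R) : 0 <= t <= n%:R ->
  (exists2 k, (k <= n)%N & t = k%:R) \/
  (exists2 k, (k < n)%N & k%:R < t < k.+1%:R).
Proof.
move=> /andP[t0 tn]; have /andP[kt tk] := truncn_itv t0.
set k := Num.truncn t in kt tk *.
have kn : (k <= n)%N by rewrite -(ler_nat R); exact: le_trans tn.
move: kt; rewrite le_eqVlt => /predU1P[kt|kt]; first by left; exists k.
right; exists k; last by rewrite kt.
by rewrite -(ltr_nat R); exact: lt_le_trans tn.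
Qed.

Lemma path_point_graph t : 0 <= t <= n%:R -> graph (path_point t).
Proof.
move=> /path_cases[[k kn ->]|[k kn /andP[kt tk]]].
  by rewrite path_point_vertex //; exact: vertex_graph.
right; exists (v k), (v k.+1), (t - k%:R); split.
- exact: path_edge_adjacent.
- by rewrite -natr1 in tk; lra.
- by apply: path_point_edge => //; rewrite !ltW.
Qed.

(** A way through [v i] and [v j] has length at least
    [|t - i| + |i - j| + |j - u|].  The other candidates for the distance come
    from an edge that contains both points: at least one end of this edge is on
    the path, and the coordinate at this end varies at unit speed. *)
Lemma path_point_dist_ge t u : 0 <= t <= n%:R -> 0 <= u <= n%:R ->
  `|t - u| <= dist (path_point t) (path_point u).
Proof.
move=> ht hu; apply: cayley_dist_ge; try exact: path_point_graph.
  move=> x y; have [[i iN ->]|zv] := on_pathP x; last by rewrite path_point_off // ltxx.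
  have [[j jN ->]|zv] := on_pathP y; last by rewrite (path_point_off _ zv) ltxx.
  rewrite !path_point_at // => /hat_gt0 -> /hat_gt0 ->; rewrite path_dist //.
  have := ler_distD i%:R t u; have := ler_distD j%:R i%:R u.
  rewrite (distrC j%:R u); lra.
move=> x y.
(* The two sums determine the positions of both points on a common edge. *)
have edge i : hat (t - i%:R) + hat (t - i.+1%:R) = 1 ->
    hat (u - i%:R) + hat (u - i.+1%:R) = 1 ->
    `|t - u| <= `|hat (t - i%:R) - hat (u - i%:R)| /\
    `|t - u| <= `|hat (t - i.+1%:R) - hat (u - i.+1%:R)|.
  rewrite -natr1 !opprD !addrA => ht1 hu1.
  have /andP[t0 t1] := hat_sum_eq1 ht1; have /andP[u0 u1] := hat_sum_eq1 hu1.
  split.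
    rewrite !hat_right ?t0 ?u0 // distrC.
    by rewrite (_ : _ - (1 - _) = u - t) //; lra.
  rewrite !hat_left; try lra.
  by rewrite (_ : _ - (1 + _) = t - u) //; lra.
have [[i iN ->]|zx] := on_pathP x; have [[j jN ->]|zy] := on_pathP y.
- move=> adj; have ij : i <> j by case: adj => vij _ eij; apply: vij; rewrite eij.
  have [eij|eij] : j = i.+1 \/ i = j.+1.
    have := word_dist_adjacent adj; have [le|/ltnW le] := leqP i j.
      by rewrite hv ?le // lern1; lia.
    by rewrite word_dist_sym hv ?le // lern1; lia.
  + rewrite !path_point_at // => h1 h2.
    by have [] := edge i; rewrite -?eij.
  + rewrite !path_point_at // addrC => h1; rewrite addrC => h2.
    by have [] := edge j; rewrite -?eij.
- rewrite !(path_point_off _ zy) !addr0 !path_point_at //.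
  by move=> _ /hat_eq1/subr0_eq -> /hat_eq1/subr0_eq ->; rewrite !subrr ?oppr0.
- rewrite !(path_point_off _ zx) !add0r !path_point_at //.
  by move=> _ /hat_eq1/subr0_eq -> /hat_eq1/subr0_eq ->; rewrite !subrr ?oppr0.
- by rewrite !path_point_off // addr0 => _ /eqP; rewrite eq_sym oner_eq0.
Qed.

(** Either a vertex of the path lies between the two points, and the way through
    the vertices has length [u - t], or both points are inside the same edge. *)
Lemma path_point_dist_le t u : 0 <= t -> u <= n%:R -> t <= u ->
  dist (path_point t) (path_point u) <= u - t.
Proof.
move=> t0 un tu.
have ht : 0 <= t <= n%:R by lra.
have hu : 0 <= u <= n%:R by lra.
have gt := path_point_graph ht; have gu := path_point_graph hu.
(* Case of a vertex [v i] between the points; [v j] is the last such vertex. *)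
have via i : t <= i%:R -> i%:R - t < 1 -> i%:R <= u ->
    dist (path_point t) (path_point u) <= u - t.
  move=> ti ti1 iu.
  have /andP[ju uj] := truncn_itv (le_trans (ler0n _ i) iu).
  set j := Num.truncn u in ju uj.
  have jN : (j <= n)%N by rewrite -(ler_nat R); exact: le_trans un.
  have ij : (i <= j)%N by rewrite -ltnS -(ltr_nat R); exact: le_lt_trans uj.
  have iN := leq_trans ij jN; rewrite -natr1 in uj.
  have hti : hat (t - i%:R) = 1 - (i%:R - t) by rewrite hat_left; lra.
  have huj : hat (u - j%:R) = 1 - (u - j%:R) by rewrite hat_right; lra.
  have := @cayley_dist_le_via _ _ (v i) (v j) gt gu.
  rewrite !path_point_at // hti huj hv ?ij // natrB //.
  by move=> /(_ _ _)/le_trans; apply; lra.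
case: (path_cases ht) => [[k kn tk]|[k kn /andP[kt tk]]].
  by apply: (via k); rewrite -tk ?subrr ?ltr01.
have [ku|uk] := leP k.+1%:R u.
  by apply: via ku; move: tk; rewrite -natr1; lra.
have kn' := ltnW kn; rewrite -natr1 in tk uk.
have hk s : t <= s <= u -> hat (s - k%:R) = 1 - (s - k%:R).
  by move=> ?; rewrite hat_in ger0_norm; lra.
have hk1 s : t <= s <= u -> hat (s - k.+1%:R) = s - k%:R.
  by move=> ?; rewrite -natr1 hat_left; lra.
apply: le_trans (cayley_dist_le_edge gt gu (path_edge_adjacent kn) _ _) _.
- by rewrite !path_point_at // hk ?hk1; lra.
- by rewrite !path_point_at // hk ?hk1; lra.
- by rewrite !path_point_at // !hk ?ger0_norm; lra.
Qed.

End DiscreteGeodesic.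

Lemma cayley_dist_sym_le p q : graph p -> graph q -> dist p q <= dist q p.
Proof.
move=> gp gq; apply: cayley_dist_ge => // u v.
  move=> qu pv; have := cayley_dist_le_via gp gq pv qu.
  by rewrite word_dist_sym; lra.
by move=> a qe pe; rewrite distrC; exact: cayley_dist_le_edge a pe qe.
Qed.

Lemma geodesic_exists x y : exists s, segment (vertex x) (vertex y) s.
Proof.
have [n [v [v0 vn _ hv]]] := discrete_geodesic x y.
eexists; exists (path_point n v), n%:R; split; last reflexivity.
have gr t : t \in `[0, n%:R] -> graph (path_point n v t).
  by rewrite in_itv => /= /path_point_graph; apply.
split=> //; first by rewrite -v0 -(path_point_vertex hv).
  by rewrite -vn path_point_vertex.
move=> t u ht hu; have gt := gr _ ht; have gu := gr _ hu.
move: ht hu; rewrite !in_itv /= => ht hu.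
apply/eqP; rewrite eq_le path_point_dist_ge // andbT.
have [tu|/ltW ut] := leP t u.
  by rewrite ler0_norm ?subr_le0 // opprB path_point_dist_le //; lra.
apply: le_trans (cayley_dist_sym_le gt gu) _.
by rewrite ger0_norm ?subr_ge0 // path_point_dist_le //; lra.
Qed.

(** * Quasiconvexity and slim triangles in terms of vertices *)

Lemma quasiconvex_vertices Q : quasiconvex R S Q <->
  exists2 K, 0 <= K & forall x y s r u, Q x -> Q y ->
    segment (vertex x) (vertex y) s -> s r -> 0 < r u ->
    exists2 q, Q q & wd u q <= K.
Proof.
split=> [[e e0 qQ]|[K K0 qQ]].
  exists (e + 3) => [|x y s r u Qx Qy sg sr ru]; first lra.
  have [_ [q Qq <-] rq] := closed_nbhd_near (qQ _ _ _ Qx Qy sg _ sr).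
  exists q => //.
  have := word_dist_le (segment_graph sg sr) (vertex_graph q) ru (vertex_gt0 q).
  lra.
exists (K + 2) => [|x y s Qx Qy sg r sr]; first lra.
have gr := segment_graph sg sr; have [u ru] := graph_support gr.
have [q Qq uq] := qQ _ _ _ _ _ Qx Qy sg sr ru.
apply: (near_closed_nbhd gr (imageP vertex Qq)).
by have := cayley_dist_le gr (vertex_graph q) ru (vertex_gt0 q); lra.
Qed.

Hypothesis HG : hyperbolic_group R S.

Lemma slim_vertices : exists2 D, 0 <= D & forall x y z sxy syz szx r u,
  segment (vertex x) (vertex y) sxy -> segment (vertex y) (vertex z) syz ->
  segment (vertex z) (vertex x) szx -> sxy r -> 0 < r u ->
  exists r' v, [/\ syz r' \/ szx r', 0 < r' v & wd u v <= D].
Proof.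
have [d d0 slim] := HG; exists (d + 3) => [|x y z sxy syz szx r u xy yz zx sr ru].
  lra.
have [r' r'yzx rr'] := closed_nbhd_near (slim _ _ _ _ _ _ xy yz zx _ sr).
have gr' : graph r' by case: r'yzx => ?; [apply: (segment_graph yz)|apply: (segment_graph zx)].
have [v r'v] := graph_support gr'; exists r', v; split=> //.
by have := word_dist_le (segment_graph xy sr) gr' ru r'v; lra.
Qed.

(** * Products of quasiconvex sets *)

(** A geodesic from [a] to [a * b] need not have its first end in [a B], but it
    forms a triangle with [a * b0]: one of the other sides has length [|b0|],
    and the other is a translate of a geodesic between elements of [B]. *)
Lemma coset_segment_near B b0 : quasiconvex R S B -> B b0 ->
  exists2 K, 0 <= K & forall a b s r u, B b ->
    segment (vertex a) (vertex (a * b)%g) s -> s r -> 0 < r u ->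
    exists2 b', B b' & wd u (a * b')%g <= K.
Proof.
move=> /quasiconvex_vertices[K K0 qB] Bb0; have [D D0 slim] := slim_vertices.
have b00 := word_dist_ge0 1%g b0.
exists (D + K + 2 * wd 1%g b0 + 2) => [|a b s r u Bb sg sr ru]; first lra.
have [t bb0] := geodesic_exists b b0.
have abb0 := translate_segment a bb0; rewrite !translate_vertex in abb0.
have [t0 ab0a] := geodesic_exists (a * b0)%g a.
have [r' [v [[[q tq qr']|t0r'] r'v uv]]] := slim _ _ _ _ _ _ _ _ sg abb0 ab0a sr ru.
  have qv : 0 < q (a^-1 * v)%g by rewrite -qr' in r'v.
  have [b' Bb' vb'] := qB _ _ _ _ _ Bb Bb0 bb0 tq qv.
  exists b' => //; have := word_dist_triangle v u (a * b')%g.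
  by rewrite -(word_dist_mul a) mulgA mulgV mul1g in vb'; lra.
exists b0 => //.
have := segment_dist_end ab0a t0r' r'v; rewrite (word_dist_sym (a * b0)%g).
have := word_dist_triangle v u (a * b0)%g.
have := word_dist_triangle a v (a * b0)%g.
by have := word_dist_mul a 1%g b0; rewrite mulg1; lra.
Qed.

(** A diagonal cuts the quadrilateral [a1 * b1], [a2 * b2], [a2], [a1] into two
    slim triangles; each of the three other sides is close to [A B]. *)
Lemma quasiconvex_mul A B : quasiconvex R S A -> quasiconvex R S B ->
  quasiconvex R S [set (a * b)%g | a in A & b in B].
Proof.
move=> qA qB; have [[b0 Bb0]|B0] := pselect (exists b, B b); last first.
  by exists 0 => // x y s [a _ [b Bb _]]; case: B0; exists b.
have [L L0 near_coset] := coset_segment_near qB Bb0.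
have [K K0 near_A] := (quasiconvex_vertices A).1 qA.
have [D D0 slim] := slim_vertices; have b00 := word_dist_ge0 1%g b0.
apply/quasiconvex_vertices; exists (2 * D + K + L + wd 1%g b0) => [|x y s r u]; first lra.
move=> [a1 Aa1 [b1 Bb1 <-]] [a2 Aa2 [b2 Bb2 <-]] sg sr ru.
have [s1 sg1] := geodesic_exists a1 (a1 * b1)%g.
have [s2 sg2] := geodesic_exists a2 (a2 * b2)%g.
have [s3 sg3] := geodesic_exists a1 a2.
have [s4 sg4] := geodesic_exists (a2 * b2)%g a1.
(* Vertices [v] close to a side from [A] to [A B], whichever of the two it is. *)
have coset_side a b s' r' v : A a -> B b ->
    segment (vertex a) (vertex (a * b)%g) s' -> s' r' -> 0 < r' v -> wd u v <= 2 * D ->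
    exists2 q, [set (a * b)%g | a in A & b in B] q &
      wd u q <= 2 * D + K + L + wd 1%g b0.
  move=> Aa Bb sg' sr' rv' uv.
  have [b' Bb' vb'] := near_coset _ _ _ _ _ Bb sg' sr' rv'.
  exists (a * b')%g; first by exists a => //; exists b'.
  by have := word_dist_triangle v u (a * b')%g; lra.
have [r' [v [[s4r'|s1r'] r'v uv]]] := slim _ _ _ _ _ _ _ _ sg sg4 sg1 sr ru; last first.
  by apply: (coset_side _ _ _ _ _ Aa1 Bb1 sg1 s1r' r'v); lra.
have [p [w [[s3p|s2p] pw vw]]] := slim _ _ _ _ _ _ _ _ sg4 sg3 sg2 s4r' r'v; last first.
  apply: (coset_side _ _ _ _ _ Aa2 Bb2 sg2 s2p pw).
  by have := word_dist_triangle v u w; lra.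
have [a Aa wa] := near_A _ _ _ _ _ Aa1 Aa2 sg3 s3p pw.
exists (a * b0)%g; first by exists a => //; exists b0.
have := word_dist_triangle v u (a * b0)%g; have := word_dist_triangle w v (a * b0)%g.
have := word_dist_triangle a w (a * b0)%g.
by have := word_dist_mul a 1%g b0; rewrite mulg1; lra.
Qed.

(** A geodesic from [1] to [1] is reduced to a point. *)
Lemma quasiconvex1 : quasiconvex R S [set 1%g].
Proof.
apply/quasiconvex_vertices; exists 2 => // _ _ s r u -> -> sg sr ru.
by exists 1%g => //; have := segment_dist_end sg sr ru; rewrite word_dist_refl add0r.
Qed.

End HyperbolicGroup.

(** * Induction on the number of factors *)

Lemma product_set0 (G : groupType) (A : 'I_0 -> set G) :
  product_set A = [set 1%g]%classic.
Proof.
apply/seteqP; split=> g /=; first by move=> [a _ ->]; rewrite big_ord0.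
by move=> ->; exists (fun=> 1%g) => [[]|] //; rewrite big_ord0.
Qed.

Lemma product_setS (G : groupType) n (A : 'I_n.+1 -> set G) :
  product_set A =
  [set (a * b)%g | a in A ord0 & b in product_set (fun i => A (lift ord0 i))]%classic.
Proof.
apply/seteqP; split=> g /=.
  move=> [a Aa ->]; exists (a ord0) => //.
  exists (\prod_(i < n) a (lift ord0 i))%g; first by exists (fun i => a (lift ord0 i)).
  by rewrite big_ord_recl.
move=> [a0 Aa0 [_ [a Aa ->] <-]].
exists (fun i => if unlift ord0 i is Some j then a j else a0).
  by move=> i; case: unliftP => [j|] ->.
rewrite big_ord_recl unlift_none; congr (_ * _)%g.
by apply: eq_bigr => i _; rewrite liftK.
Qed.

Theorem proposition1 (R : realType) (G : groupType) (S : set G)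
  (HS : finite_symmetrized_generating_set S)
  (HG : hyperbolic_group R S)
  (n : nat) (Hn : (1 <= n)%N) (A : 'I_n -> set G)
  (HA : forall i : 'I_n, quasiconvex R S (A i)) :
  quasiconvex R S (product_set A).
Proof.
elim: n {Hn} A HA => [|n IH] A HA.
  by rewrite product_set0; exact: quasiconvex1.
by rewrite product_setS; apply: quasiconvex_mul => //; exact: IH.
Qed.
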